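(* Let $T$ be a tree of order $n\geq 2$. Then $$2\cos\frac{\pi}{n+1}\leq \rho_{ag}(P_n)\leq \rho_{ag}(T)\leq \rho_{ag}(S_n)=\frac{n}{2},$$ where $\rho_{ag}(P_n)=\rho_{ag}(T)$ holds if and only if $T\cong P_n$, and $\rho_{ag}(T)=\rho_{ag}(S_n)$ holds if and only if $T\cong S_n$.
   Context: All graphs are finite, simple and undirected. For a graph $G$ with vertex set $\{v_1,\dots,v_n\}$, let $d_i$ denote the degree of $v_i$. The arithmetic-geometric matrix $A_{ag}(G)$ is the $n\times n$ matrix whose $(i,j)$-entry is $\frac{d_i+d_j}{2\sqrt{d_i d_j}}$ if $v_i$ and $v_j$ are adjacent and $0$ otherwise; $\rho_{ag}(G)$ denotes its largest eigenvalue. $P_n$ is the path on $n$ vertices and $S_n$ is the star on $n$ vertices (i.e. $K_{1,n-1}$). *)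

(* Defs.v *)
From HB Require Import structures.
From mathcomp Require Import all_boot all_order all_algebra.
From mathcomp Require Import classical_sets reals.
Set Implicit Arguments.
Unset Strict Implicit.
Unset Printing Implicit Defensive.
Import Order.TTheory GRing.Theory Num.Theory.
Local Open Scope ring_scope.

Record sgraph (n : nat) := SGraph {
  adj :> rel 'I_n;
  adj_sym : symmetric adj;
  adj_irrefl : irreflexive adj }.

Section Graphs.
Variable n : nat.

Definition deg (G : sgraph n) (v : 'I_n) : nat := #|[pred w | G v w]|.

Definition connected_graph (G : sgraph n) : Prop :=
  (0 < n)%N /\ forall u v : 'I_n, connect G u v.

(* The bound on the length is needed: in a symmetric relation [:: u; v] is a
   [ucycle] for each edge uv. *)
Definition acyclic_graph (G : sgraph n) : Prop :=
  forall c : seq 'I_n, (2 < size c)%N -> ~ ucycle G c.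

Definition is_tree (G : sgraph n) : Prop :=
  connected_graph G /\ acyclic_graph G.

Definition graph_iso (G H : sgraph n) : Prop :=
  exists2 f : 'I_n -> 'I_n, bijective f & forall u v, H (f u) (f v) = G u v.

Definition path_rel : rel 'I_n := [rel i j : 'I_n | (i.+1 == j) || (j.+1 == i)].

Lemma path_rel_sym : symmetric path_rel.
Proof. by move=> i j; rewrite /path_rel /= orbC. Qed.

Lemma path_rel_irrefl : irreflexive path_rel.
Proof. by move=> i; rewrite /path_rel /= orbb gtn_eqF. Qed.

Definition path_graph : sgraph n := SGraph path_rel_sym path_rel_irrefl.

(* Exactly one endpoint of each edge is the centre, vertex 0. *)
Definition star_rel : rel 'I_n :=
  [rel i j : 'I_n | (i == 0 :> nat) (+) (j == 0 :> nat)].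

Lemma star_rel_sym : symmetric star_rel.
Proof. by move=> i j; rewrite /star_rel /= addbC. Qed.

Lemma star_rel_irrefl : irreflexive star_rel.
Proof. by move=> i; rewrite /star_rel /= addbb. Qed.

Definition star_graph : sgraph n := SGraph star_rel_sym star_rel_irrefl.

Definition ag_mx (R : realType) (G : sgraph n) : 'M[R]_n :=
  \matrix_(i, j)
    if G i j then
      ((deg G i)%:R + (deg G j)%:R)
        / (2 * Num.sqrt ((deg G i)%:R * (deg G j)%:R))
    else 0.

(* [ag_mx R G] is real symmetric, so for 0 < n its set of eigenvalues in R is
   finite and nonempty, and the supremum is the largest eigenvalue. *)
Definition rho_ag (R : realType) (G : sgraph n) : R :=
  sup [set a : R | eigenvalue (ag_mx R G) a]%classic.

End Graphs.

Arguments path_graph n : clear implicits.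
Arguments star_graph n : clear implicits.

(* Main.v *)
(* Let A be the matrix A_ag(G) and let x_i = sqrt d_i. Then
   (x A)_j = x_j (d_j + m_j) / 2, where m_j is the mean degree of the neighbours
   of j. By comparison with the positive vector x, rho_ag(G) <= k/2 as soon as
   d_i + d_j <= k on every edge, and for G connected equality forces
   d_i + d_j = k on every edge. In a tree d_i + d_j <= n, because there are no
   triangles; if
   d_i + d_j = n on every edge, then edges uv, uw, vx force wx to be an edge, so
   the absence of 4-cycles leaves only the star. On a path
   d_i + d_j <= 4 with strict inequality at the ends, so rho_ag(P_n) < 2.

   Conversely, the Rayleigh quotient of A at x is (sum d_i^2) / (sum d_i). In a
   connected graph sum d_i >= 2(n-1), and d^2 + 2 >= 3d, so a vertex of degree at
   least 3 makes this quotient at least 2. Hence rho_ag(T) >= 2 > rho_ag(P_n)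
   for every tree that is not a path. The lower bound on rho_ag(P_n) is the
   Rayleigh quotient at the Perron vector sin(i pi / (n+1)) of the adjacency
   matrix, as the nonzero entries of A are at least 1. *)
Require Import Defs.
From mathcomp Require Import all_boot all_order all_algebra.
From mathcomp Require Import boolp classical_sets reals topology normedtype.
From mathcomp Require Import derive trigo.
From mathcomp Require Import perm zify ring lra.
Set Implicit Arguments.
Unset Strict Implicit.
Unset Printing Implicit Defensive.
Import Order.TTheory GRing.Theory Num.Theory numFieldNormedType.Exports.
Local Open Scope ring_scope.

(** * Rayleigh quotients of real symmetric matrices *)

Section Spectrum.
Variables (R : realType) (n : nat).
Implicit Types (A : 'M[R]_n) (x y : 'rV[R]_n).

(** Rows are used because [eigenvalue] refers to vectors with [v *m A = a *: v]. *)
Definition dotv x y : R := (x *m y^T) 0 0.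

Lemma dotvE x y : dotv x y = \sum_i x 0 i * y 0 i.
Proof. by rewrite /dotv mxE; apply: eq_bigr => i _; rewrite mxE. Qed.

Lemma dotvC x y : dotv x y = dotv y x.
Proof. by rewrite !dotvE; apply: eq_bigr => i _; rewrite mulrC. Qed.

Lemma dotvDl x y z : dotv (x + y) z = dotv x z + dotv y z.
Proof. by rewrite /dotv mulmxDl mxE. Qed.

Lemma dotvZl a x y : dotv (a *: x) y = a * dotv x y.
Proof. by rewrite /dotv -scalemxAl mxE. Qed.

Lemma dotvDr x y z : dotv x (y + z) = dotv x y + dotv x z.
Proof. by rewrite dotvC dotvDl !(dotvC x). Qed.

Lemma dotvZr a x y : dotv x (a *: y) = a * dotv x y.
Proof. by rewrite dotvC dotvZl dotvC. Qed.

Lemma dotv_mulmx A x y : A^T = A -> dotv (x *m A) y = dotv x (y *m A).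
Proof. by move=> sA; rewrite /dotv trmx_mul sA mulmxA. Qed.

Lemma dotv_ge0 x : 0 <= dotv x x.
Proof. by rewrite dotvE; apply: sumr_ge0 => i _; rewrite -expr2 sqr_ge0. Qed.

Lemma dotv_eq0 x : (dotv x x == 0) = (x == 0).
Proof.
apply/idP/eqP => [|->]; last by rewrite /dotv mul0mx mxE.
rewrite dotvE psumr_eq0 => [/allP x0|i _]; last by rewrite -expr2 sqr_ge0.
apply/rowP => i; have := x0 i (mem_index_enum i).
by rewrite /= mulf_eq0 orbb mxE => /eqP.
Qed.

Lemma dotv_gt0 x : (0 < dotv x x) = (x != 0).
Proof. by rewrite lt0r dotv_ge0 dotv_eq0 andbT. Qed.

Lemma continuous_dotv_mulmx A : continuous (fun x => dotv (x *m A) x).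
Proof.
have -> : (fun x => dotv (x *m A) x)
  = (fun x => \sum_i (\sum_j x 0 j * A j i) * x 0 i).
  by apply/funext => x; rewrite dotvE; apply: eq_bigr => i _; rewrite mxE.
have ctsum (F : 'I_n -> 'rV[R]_n -> R) :
    (forall i, continuous (F i)) -> continuous (fun x => \sum_i F i x).
  by move=> cF; apply: continuous_big => [|i _]; [exact: add_continuous|exact: cF].
have ccol i : continuous (fun x : 'rV[R]_n => \sum_j x 0 j * A j i).
  apply: (ctsum) => j x; apply: (@cvgM _ _ _ (nbhs_filter x)).
    exact: coord_continuous.
  exact: cvg_cst.
apply: ctsum => i x; apply: (@cvgM _ _ _ (nbhs_filter x)); first exact: ccol.
exact: coord_continuous.
Qed.

Lemma continuous_dotv : continuous (fun x : 'rV[R]_n => dotv x x).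
Proof.
have -> : (fun x => dotv x x) = (fun x => dotv (x *m 1%:M) x).
  by apply/funext => x; rewrite mulmx1.
exact: continuous_dotv_mulmx.
Qed.

Lemma compact_sphere : compact [set x : 'rV[R]_n | dotv x x = 1]%classic.
Proof.
apply: bounded_closed_compact.
  (* The norm on ['rV[R]_n] is the maximum norm, and each squared coordinate is at most the sum of
     squares, which is 1. *)
  exists 1; split => // M M1 x /= x1; rewrite (le_trans _ (ltW M1)) //.
  rewrite /Num.norm /= mx_normrE.
  apply: bigmax_le => // -[i j] _ /=; rewrite (ord1 i).
  rewrite -(@expr_le1 _ 2) // -normrX ger0_norm ?sqr_ge0 //.
  rewrite -x1 dotvE (bigD1 j) //= expr2 lerDl.
  by apply: sumr_ge0 => k _; rewrite -expr2 sqr_ge0.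
apply: (@closed_comp _ _ (fun x => dotv x x) [set 1]%classic).
  by move=> x _; apply: continuous_dotv.
exact: closed_eq.
Qed.

(* Applied to [M%:M - A], where [M] is the maximum of the Rayleigh quotient. *)
Lemma psd_isotropic A x : A^T = A -> (forall y, 0 <= dotv (y *m A) y) ->
  dotv (x *m A) x = 0 -> x *m A = 0.
Proof.
move=> sA A0 x0; set w := x *m A; apply/eqP; rewrite -dotv_eq0.
set s := dotv w w; set c := dotv (w *m A) w.
have c0 : 0 <= c by apply: A0.
have s0 : 0 <= s by apply: dotv_ge0.
(* This is the form at x + t w; its constant term vanishes because x is isotropic. *)
have H t : 0 <= 2 * t * s + t ^+ 2 * c.
  have := A0 (x + t *: w).
  rewrite mulmxDl -scalemxAl !(dotvDl, dotvDr, dotvZl, dotvZr) -/w x0.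
  rewrite (dotv_mulmx w x sA) -/w -/s -/c; lra.
have [s_gt0|] := ltP 0 s; last by move=> sle; apply/eqP/le_anti/andP.
have c1 : c + 1 != 0 by apply: lt0r_neq0; lra.
(* A small negative t makes the linear term win if s > 0; dividing by c + 1 avoids a separate case c
   = 0. *)
have := H (- s / (c + 1)).
have -> : 2 * (- s / (c + 1)) * s + (- s / (c + 1)) ^+ 2 * c
  = - (s / (c + 1)) ^+ 2 * (c + 2) by field.
rewrite mulNr oppr_ge0 leNgt mulr_gt0 //; last by lra.
by rewrite exprn_gt0 // divr_gt0 //; lra.
Qed.

(** The quadratic form attains its maximum M on the compact unit sphere. By homogeneity M - A is
    positive semidefinite, and it is isotropic at the maximiser, which therefore lies in its
    kernel. *)
Lemma rayleigh_max A : (0 < n)%N -> A^T = A ->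
  exists2 M, eigenvalue A M & forall x, dotv (x *m A) x <= M * dotv x x.
Proof.
move=> n0 sA.
pose e : 'rV[R]_n := delta_mx 0 (Ordinal n0).
have e1 : dotv e e = 1.
  rewrite dotvE (bigD1 (Ordinal n0)) //= big1 ?addr0 => [|i /negPf ni].
    by rewrite !mxE !eqxx mulr1.
  by rewrite !mxE ni andbF mul0r.
have [||x] := @EVT_max_rV R n (fun x => dotv (x *m A) x) _ _ compact_sphere.
- by exists e.
- by apply: continuous_subspaceT; apply: continuous_dotv_mulmx.
rewrite inE /= => x1; set M := dotv _ _ => xM.
have ray y : dotv (y *m A) y <= M * dotv y y.
  have [->|y0] := eqVneq y 0; first by rewrite /dotv !mul0mx mxE mulr0.
  have sy : 0 < dotv y y by rewrite dotv_gt0.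
  have := xM ((Num.sqrt (dotv y y))^-1 *: y).
  have rr : (Num.sqrt (dotv y y))^-1 * (Num.sqrt (dotv y y))^-1 = (dotv y y)^-1.
    by rewrite -expr2 exprVn sqr_sqrtr // ltW.
  rewrite inE /= -scalemxAl !dotvZl !dotvZr !mulrA rr mulVf ?gt_eqF // => /(_ erefl).
  by rewrite mulrC ler_pdivrMr.
exists M => //; apply/eigenvalueP; exists x; last by rewrite -dotv_gt0 x1.
have BE y : y *m (M%:M - A) = M *: y - y *m A by rewrite mulmxBr mul_mx_scalar.
have BQ y : dotv (y *m (M%:M - A)) y = M * dotv y y - dotv (y *m A) y.
  by rewrite BE dotvDl dotvZl -scaleN1r dotvZl mulN1r.
apply/esym/eqP; rewrite -subr_eq0 -BE; apply/eqP/psd_isotropic.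
- by rewrite linearB /= tr_scalar_mx sA.
- by move=> y; rewrite BQ subr_ge0.
- by rewrite BQ x1 mulr1 subrr.
Qed.

(** * Comparison of eigenvalues with a positive vector *)

Section Supersolution.
Variables (A : 'M[R]_n) (x : 'rV[R]_n) (c : R).
Hypotheses (A_ge0 : forall i j, 0 <= A i j) (x_gt0 : forall i, 0 < x 0 i).
Hypothesis xA_le : forall j, (x *m A) 0 j <= c * x 0 j.

(** Here t is the maximum of |y_i| / x_i, so t x dominates |y| and touches it at j. *)
Lemma ratio_argmax (y : 'rV[R]_n) : y != 0 ->
  exists t j, [/\ 0 < t, forall i, `|y 0 i| <= t * x 0 i & `|y 0 j| = t * x 0 j].
Proof.
case/rV0Pn => k yk.
have [j _ jmax] := @arg_maxP _ R 'I_n k xpredT (fun i => `|y 0 i| / x 0 i) isT.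
exists (`|y 0 j| / x 0 j), j; split.
- by apply: lt_le_trans (jmax k isT); rewrite divr_gt0 // normr_gt0.
- by move=> i; rewrite -ler_pdivrMr //; exact: jmax.
- by rewrite divfK // gt_eqF.
Qed.

Lemma eigen_touch a y t j : y *m A = a *: y -> 0 < t ->
    (forall i, `|y 0 i| <= t * x 0 i) -> `|y 0 j| = t * x 0 j ->
  a * (t * x 0 j) <= \sum_i `|y 0 i| * A i j.
Proof.
move=> yA t0 ymax <-; apply: (@le_trans _ _ `|(y *m A) 0 j|).
  by rewrite yA mxE normrM ler_wpM2r // ler_norm.
rewrite mxE; apply: le_trans (ler_norm_sum _ _ _) _.
by apply: ler_sum => i _; rewrite normrM (ger0_norm (A_ge0 i j)).
Qed.

Lemma sum_ratio_le y t j : (forall i, `|y 0 i| <= t * x 0 i) ->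
  \sum_i `|y 0 i| * A i j <= t * (x *m A) 0 j.
Proof.
move=> ymax; rewrite mxE mulr_sumr; apply: ler_sum => i _.
by rewrite mulrA ler_wpM2r.
Qed.

(** At a touching index j, a t x_j <= sum_i |y_i| A_ij <= t (x A)_j <= c t x_j, and t x_j > 0
    cancels. *)
Lemma eigenvalue_le a : eigenvalue A a -> a <= c.
Proof.
case/eigenvalueP => y yA /ratio_argmax[t [j [t0 ymax yj]]].
have := le_trans (eigen_touch yA t0 ymax yj) (sum_ratio_le j ymax).
have tx : 0 < t * x 0 j by rewrite mulr_gt0.
move=> /le_trans/(_ (ler_wpM2l (ltW t0) (xA_le j))).
by rewrite [X in _ <= X -> _]mulrCA ler_pM2r.
Qed.

(* The set of indices where |y| / x is maximal is closed under adjacency. *)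
Lemma eigenvalue_eq (e : rel 'I_n) : symmetric e ->
    (forall i j, e i j -> 0 < A i j) -> (forall i j, connect e i j) ->
  eigenvalue A c -> forall j, (x *m A) 0 j = c * x 0 j.
Proof.
move=> sym_e A_gt0 conn /eigenvalueP[y yA /ratio_argmax[t [k [t0 ymax yk]]]].
pose S := [pred i | `|y 0 i| == t * x 0 i].
(* With a = c the chain of inequalities begins and ends at the same value, so every link is an
   equality at every touching index. *)
have tight j : j \in S -> t * (x *m A) 0 j = t * (c * x 0 j) /\
    \sum_i `|y 0 i| * A i j = t * (x *m A) 0 j.
  move/eqP => yj; have le1 := eigen_touch yA t0 ymax yj.
  have le2 := sum_ratio_le j ymax.
  have le3 : t * (x *m A) 0 j <= t * (c * x 0 j) by rewrite ler_wpM2l // ltW.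
  rewrite mulrCA in le1.
  by split; apply/le_anti; rewrite ?le3 ?le2 //= ?(le_trans le1) // (le_trans le3).
have clS : fingraph.closed e S.
  apply: intro_closed; first exact: sym_connect_sym.
  (* The terms (t x_i - |y_i|) A_ij are nonnegative with sum 0, hence all vanish; A_ij > 0 then puts
     i in [S]. *)
  move=> j i eji /tight[_ /eqP]; rewrite mxE mulr_sumr -subr_eq0 -sumrB.
  rewrite -oppr_eq0 -sumrN psumr_eq0 => [|l _].
    move/allP/(_ i (mem_index_enum i)).
    rewrite /= mulrA -mulrBl oppr_eq0 mulf_eq0 subr_eq0 => /orP[//|].
    by rewrite gt_eqF // A_gt0 // sym_e.
  by rewrite opprB mulrA -mulrBl mulr_ge0 // subr_ge0.
move=> j; have jS : j \in S.
  by rewrite -(closed_connect clS (conn k j)); apply/eqP.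
by have [/(mulfI (lt0r_neq0 t0))] := tight j jS.
Qed.

End Supersolution.
End Spectrum.

(** * The arithmetic-geometric matrix and its test vector *)

Lemma leif_pM2r (R : numDomainType) (z x y : R) C : 0 < z ->
  (x * z <= y * z ?= iff C) <-> (x <= y ?= iff C).
Proof.
by move=> z0; rewrite /Order.leif ler_pM2r // (inj_eq (mulIf (lt0r_neq0 z0))).
Qed.

Section AG.
Variables (R : realType) (n : nat).
Implicit Types G : sgraph n.

Lemma ag_mx_tr G : (ag_mx R G)^T = ag_mx R G.
Proof.
apply/matrixP => i j; rewrite !mxE adj_sym.
by case: ifP => // _; rewrite addrC (mulrC (deg G j)%:R).
Qed.

Lemma deg_gt0 G i j : G i j -> (0 < deg G i)%N.
Proof. by move=> Gij; apply/card_gt0P; exists j. Qed.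

(** The arithmetic mean of the two degrees is at least their geometric mean; after squaring this is
    (d_i - d_j)^2 >= 0. *)
Lemma ag_mx_ge1 G i j : G i j -> 1 <= ag_mx R G i j.
Proof.
move=> Gij; rewrite mxE Gij.
have di : 0 < (deg G i)%:R :> R by rewrite ltr0n (deg_gt0 Gij).
have dj : 0 < (deg G j)%:R :> R by rewrite ltr0n (@deg_gt0 G j i) // adj_sym.
rewrite ler_pdivlMr ?mulr_gt0 ?sqrtr_gt0 ?mulr_gt0 // mul1r.
rewrite -(@ler_pXn2r _ 2) ?nnegrE ?mulr_ge0 ?addr_ge0 ?sqrtr_ge0 ?ler0n //.
rewrite exprMn sqr_sqrtr ?mulr_ge0 ?ler0n //.
have := sqr_ge0 ((deg G i)%:R - (deg G j)%:R : R); lra.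
Qed.

Lemma ag_mx_ge0 G i j : 0 <= ag_mx R G i j.
Proof.
have [Gij|/negPf Gij] := boolP (G i j); last by rewrite mxE Gij.
by apply: le_trans (ag_mx_ge1 Gij).
Qed.

(** The Rayleigh maximum is an eigenvalue, and it bounds every other one through the form at an
    eigenvector; so it is the supremum. *)
Lemma rho_agP G : (0 < n)%N -> eigenvalue (ag_mx R G) (rho_ag R G) /\
  forall x, dotv (x *m ag_mx R G) x <= rho_ag R G * dotv x x.
Proof.
move=> n0; have [M eM ray] := rayleigh_max n0 (ag_mx_tr G).
suff -> : rho_ag R G = M by [].
have ubM : ubound [set a : R | eigenvalue (ag_mx R G) a]%classic M.
  move=> a /= /eigenvalueP[v vA v0]; have := ray v.
  by rewrite vA dotvZl ler_pM2r // dotv_gt0.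
apply/le_anti/andP; split; first by apply: ge_sup => //; exists M.
by apply: ub_le_sup => //; exists M.
Qed.

(** Chosen to clear the radicals: x_i A_ij x_j = (d_i + d_j) / 2 on each edge. *)
Definition sqrt_deg G : 'rV[R]_n := \row_i Num.sqrt (deg G i)%:R.

Lemma sqrt_deg_gt0 G : (forall i, (0 < deg G i)%N) -> forall i, 0 < sqrt_deg G 0 i.
Proof. by move=> d0 i; rewrite mxE sqrtr_gt0 ltr0n. Qed.

Lemma sqrt_deg_ag G j : (0 < deg G j)%N ->
  (sqrt_deg G *m ag_mx R G) 0 j =
  (\sum_(i | G j i) (deg G i + deg G j)%:R) / (2 * (deg G j)%:R) * sqrt_deg G 0 j.
Proof.
move=> dj; rewrite mxE (bigID (G j)) /= [X in _ + X]big1 => [|i /negPf nG].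
  rewrite addr0 !mulr_suml; apply: eq_bigr => i Gji; rewrite !mxE adj_sym Gji.
  have di : (0 < deg G i)%N by rewrite (@deg_gt0 G i j) // adj_sym.
  rewrite sqrtrM ?ler0n // natrD.
  have si : Num.sqrt (deg G i)%:R != 0 :> R by rewrite gt_eqF // sqrtr_gt0 ltr0n.
  have sj : Num.sqrt (deg G j)%:R != 0 :> R by rewrite gt_eqF // sqrtr_gt0 ltr0n.
  rewrite -[X in _ / (2 * X) * _](@sqr_sqrtr _ (deg G j)%:R) ?ler0n //.
  by field; apply/andP.
by rewrite [ag_mx _ _ _ _]mxE adj_sym nG mulr0.
Qed.

(** Writing k/2 as the sum of k over the d_j neighbours, divided by 2 d_j, reduces both the bound
    and its equality case to a termwise comparison. *)
Lemma sqrt_deg_ag_le G k j : (0 < deg G j)%N ->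
    (forall i, G j i -> (deg G i + deg G j <= k)%N) ->
  (sqrt_deg G *m ag_mx R G) 0 j <= k%:R / 2 * sqrt_deg G 0 j
  ?= iff [forall (i | G j i), (deg G i + deg G j == k)%N].
Proof.
move=> dj dle; rewrite sqrt_deg_ag //; apply/leif_pM2r; first by rewrite mxE sqrtr_gt0 ltr0n.
have -> : k%:R / 2 = (\sum_(i | G j i) k%:R) / (2 * (deg G j)%:R) :> R.
  rewrite sumr_const -[#|_|]/(deg G j) -mulr_natr; field.
  by rewrite pnatr_eq0 -lt0n.
apply/leif_pM2r; first by rewrite invr_gt0 mulr_gt0 // ltr0n.
rewrite (_ : [forall (i | _), _] =
    [forall (i | G j i), (deg G i + deg G j)%:R == k%:R :> R]).
  by apply: leif_sum => i Gji; split => //; rewrite ler_nat dle.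
by apply: eq_forallb => i; rewrite eqr_nat.
Qed.

(** * Spectral radius and degree sums along edges *)

Section Bound.
Variables (G : sgraph n) (k : nat).
Hypothesis n_gt1 : (1 < n)%N.
Hypothesis conn : forall u v, connect G u v.
Hypothesis dle : forall i j, G i j -> (deg G i + deg G j <= k)%N.

Lemma connected_deg_gt0 i : (0 < deg G i)%N.
Proof.
have [j ij] : exists j : 'I_n, i != j.
  have /card_gt0P[j] : (0 < #|predC1 i|)%N by rewrite cardC1 card_ord; case: n n_gt1 => [|[]].
  by rewrite inE eq_sym; exists j.
have /connectP[[|k' p] /=] := conn i j; first by move=> _ /esym/eqP; rewrite (negPf ij).
by case/andP => /deg_gt0.
Qed.

Lemma rho_ag_le : rho_ag R G <= k%:R / 2.
Proof.
have [e _] := rho_agP G (ltnW n_gt1).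
apply: (eigenvalue_le (@ag_mx_ge0 G) (sqrt_deg_gt0 connected_deg_gt0)) e => j.
apply: sqrt_deg_ag_le => [|i]; first exact: connected_deg_gt0.
by rewrite adj_sym; apply: dle.
Qed.

Lemma rho_ag_eq : rho_ag R G = k%:R / 2 -> forall i j, G i j -> (deg G i + deg G j)%N = k.
Proof.
have [e _] := rho_agP G (ltnW n_gt1) => rE; rewrite rE in e.
have le j : _ <= _ ?= iff _ := sqrt_deg_ag_le (connected_deg_gt0 j)
  (fun i (Gji : G j i) => dle (etrans (adj_sym G i j) Gji)).
have H : forall j, (sqrt_deg G *m ag_mx R G) 0 j = k%:R / 2 * sqrt_deg G 0 j.
  apply: (eigenvalue_eq (@ag_mx_ge0 G) (sqrt_deg_gt0 connected_deg_gt0) _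
    (@adj_sym _ G) _ conn e) => [j|i j /ag_mx_ge1]; first exact: le.
  exact: lt_le_trans.
move=> i j Gij; apply/eqP.
have [_] := le j; rewrite H eqxx => /esym/forall_inP; apply.
by rewrite adj_sym.
Qed.

End Bound.

(** With constant degree sum on edges, [sqrt_deg] is itself an eigenvector for k/2, so the Rayleigh
    bound matches the upper bound. *)
Lemma rho_ag_biregular G k : (1 < n)%N -> (forall u v, connect G u v) ->
  (forall i j, G i j -> (deg G i + deg G j)%N = k) -> rho_ag R G = k%:R / 2.
Proof.
move=> n1 conn dk; have d0 := connected_deg_gt0 n1 conn.
apply/le_anti/andP; split.
  by apply: rho_ag_le => // i j /dk ->.
have [_ /(_ (sqrt_deg G))] := rho_agP G (ltnW n1).
have -> : sqrt_deg G *m ag_mx R G = k%:R / 2 *: sqrt_deg G.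
  apply/rowP => j; rewrite [RHS]mxE; apply/eqP.
  rewrite (sqrt_deg_ag_le (d0 j)) => [|i]; last by rewrite adj_sym => /dk ->.
  by apply/forall_inP => i; rewrite adj_sym => /dk ->.
rewrite dotvZl ler_pM2r // dotv_gt0; apply/rV0Pn.
by exists (Ordinal (ltnW n1)); rewrite gt_eqF // sqrt_deg_gt0.
Qed.

End AG.

(** * Structure of acyclic and connected graphs *)

Section Trees.
Variables (n : nat) (G : sgraph n).
Local Open Scope nat_scope.

Lemma star_graphE u v : star_graph n u v = (u == 0 :> nat) (+) (v == 0 :> nat).
Proof. by []. Qed.

Lemma path_graphE u v : path_graph n u v = (u.+1 == v) || (v.+1 == u).
Proof. by []. Qed.

Lemma adj_neq u v : G u v -> u != v.
Proof. by move=> Guv; apply/eqP => uv; rewrite uv adj_irrefl in Guv. Qed.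

Lemma acyclic_triangle u v w :
  acyclic_graph G -> G u v -> G v w -> G w u -> False.
Proof.
move=> ac uv vw wu; apply: (ac [:: u; v; w]) => //.
rewrite /ucycle /= uv vw wu /= !inE negb_or.
by rewrite (adj_neq uv) (adj_neq vw) eq_sym (adj_neq wu).
Qed.

Lemma acyclic_square u v w z :
  acyclic_graph G -> u != w -> v != z ->
  G u v -> G v w -> G w z -> G z u -> False.
Proof.
move=> ac uw vz uv vw wz zu; apply: (ac [:: u; v; w; z]) => //.
rewrite /ucycle /= uv vw wz zu /= !inE !negb_or.
by rewrite (adj_neq uv) (adj_neq vw) (adj_neq wz) uw vz eq_sym (adj_neq zu).
Qed.

(** Adjacent vertices have disjoint neighbourhoods, since a common neighbour would close a
    triangle. *)
Lemma acyclic_degD u v : acyclic_graph G -> G u v ->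
  deg G u + deg G v = #|[predU G u & G v]|.
Proof.
move=> ac uv; rewrite -cardUI [X in _ + X]eq_card0 ?addn0 // => w.
rewrite !inE; apply/negP => /andP[uw vw].
by apply: (acyclic_triangle ac uv vw); rewrite adj_sym.
Qed.

Lemma acyclic_degD_le u v : acyclic_graph G -> G u v -> deg G u + deg G v <= n.
Proof. by move=> ac /acyclic_degD ->//; rewrite -[X in _ <= X]card_ord max_card. Qed.

Lemma acyclic_degD_cover u v w : acyclic_graph G -> G u v ->
  deg G u + deg G v = n -> G u w || G v w.
Proof.
move=> ac uv; rewrite acyclic_degD // => cn.
have /subset_cardP : #|[predU G u & G v]| = #|'I_n| by rewrite card_ord.
by move=> /(_ (subset_predT _))/(_ w); rewrite !inE.
Qed.

Lemma adj_other u v : 1 < deg G u -> exists2 w, w != v & G u w.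
Proof.
move=> du; have /card_gt0P[w] : 0 < #|[predD1 [pred w | G u w] & v]|.
  move: du; rewrite /deg (cardD1 v [pred w | G u w]) inE.
  by case: (G u v) => //= /ltnW.
by rewrite !inE => /andP[]; exists w.
Qed.

(** Swapping c with vertex 0 is the isomorphism: an edge avoiding c would form a triangle with
    it. *)
Lemma star_center_iso c : 0 < n -> acyclic_graph G ->
  (forall v, v != c -> G c v) -> graph_iso G (star_graph n).
Proof.
move=> n0 ac Gc; pose z := Ordinal n0.
exists (tperm c z) => [|u v]; first by apply: injF_bij; exact: perm_inj.
have f0 w : (tperm c z w == 0 :> nat) = (w == c).
  by rewrite -[in RHS](inj_eq (@perm_inj _ (tperm c z))) tpermL.
rewrite star_graphE !f0; have [->|uc] := eqVneq u c; have [->|vc] := eqVneq v c => /=.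
- by rewrite adj_irrefl.
- by rewrite Gc.
- by rewrite adj_sym Gc.
apply/esym/negP => uv; apply: (acyclic_triangle ac uv (w := c)).
  by rewrite adj_sym Gc.
exact: Gc.
Qed.

Lemma acyclic_biregular_star : 1 < n -> acyclic_graph G ->
    (exists u v, G u v) -> (forall u v, G u v -> deg G u + deg G v = n) ->
  graph_iso G (star_graph n).
Proof.
move=> n1 ac [u [v uv]] dn.
(* The neighbour b of a leaf has degree n - 1, so it is adjacent to all other vertices. *)
have center a b : G a b -> deg G a = 1 -> forall w, w != b -> G b w.
  move=> ab da; have : deg G b = #|predC1 b|.
    by have := dn _ _ ab; rewrite cardC1 card_ord da; lia.
  move/subset_cardP => sub w wb.
  have /sub/(_ w) : [pred x | G b x] \subset predC1 b.
    by apply/fintype.subsetP => x; rewrite !inE eq_sym; exact: adj_neq.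
  by rewrite !inE wb.
have vu : G v u by rewrite adj_sym.
have [du|du] := eqVneq (deg G u) 1.
  by apply: (@star_center_iso v) => //; [lia|exact: center du].
have [dv|dv] := eqVneq (deg G v) 1.
  by apply: (@star_center_iso u) => //; [lia|exact: center dv].
have u0 := deg_gt0 uv; have v0 := deg_gt0 vu.
have [|w wv uw] := @adj_other u v; first by lia.
have [|x xu vx] := @adj_other v u; first by lia.
have wu : G w u by rewrite adj_sym.
(* Neither end of uv is a leaf, so there is a path w, u, v, x. The neighbourhoods of u and w cover
   x, which closes the triangle u v x or the square x v u w. *)
case/orP: (acyclic_degD_cover x ac uw (dn _ _ uw)) => [ux|wx].
  by case: (acyclic_triangle ac uv vx); rewrite adj_sym.
by case: (@acyclic_square x v u w ac xu _ _ vu uw wx); rewrite // 1?eq_sym // adj_sym.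
Qed.

(** A set without outgoing edges is a union of components; if it is nonempty, connectedness makes it
    everything. *)
Lemma connected_boundary (S : {set 'I_n}) : (forall u v, connect G u v) ->
  0 < #|S| < n -> exists u v, [/\ u \in S, v \notin S & G u v].
Proof.
move=> conn /andP[/card_gt0P[a aS] Sn].
have /existsP[u /existsP[v /and3P[]]] :
    [exists u, exists v, [&& u \in S, v \notin S & G u v]]; last by exists u, v.
apply: contraLR Sn => H; rewrite -leqNgt -[n in n <= _]card_ord -cardsT.
apply: subset_leq_card; apply/fintype.subsetP => b _.
rewrite -(@closed_connect _ G (mem S) _ _ _ (conn a b)) //.
apply: intro_closed; first exact: sym_connect_sym (@adj_sym _ G).
move=> u v uv uS; apply: contraNT H => vS.
by apply/existsP; exists u; apply/existsP; exists v; apply/and3P.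
Qed.

(** A vertex set grows by one boundary vertex at a time; each new vertex brings at least one edge,
    which adds 2 to the sum of the degrees inside the set. *)
Lemma connected_sum_deg : 0 < n -> (forall u v, connect G u v) ->
  n.-1.*2 <= \sum_v deg G v.
Proof.
move=> n0 conn.
have H k : k < n -> exists2 S : {set 'I_n}, #|S| = k.+1 &
    k.*2 <= \sum_(i in S) #|[pred j in S | G i j]|.
  elim: k => [|k IH] kn; first by exists [set Ordinal n0]; rewrite ?cards1.
  have [|S Sk Sle] := IH; first by lia.
  have [|u [w [uS wS uw]]] := connected_boundary (S := S) conn; first by lia.
  exists (w |: S); first by rewrite cardsU1 wS Sk.
  rewrite big_setU1 //= (bigD1 u) //=.
  rewrite (bigD1 u) //= in Sle.
  have wN : 0 < #|[pred j in w |: S | G w j]|.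
    by apply/card_gt0P; exists u; rewrite !inE uS orbT adj_sym.
  (* The edge uw is counted a second time at its old endpoint u. *)
  have uN : #|[pred j in S | G u j]| < #|[pred j in w |: S | G u j]|.
    rewrite [X in _ < X](cardD1 w) !inE eqxx uw /= add1n ltnS.
    apply: subset_leq_card; apply/fintype.subsetP => j; rewrite !inE => /andP[jS ->].
    by rewrite jS orbT !andbT; apply: contraNneq wS => <-.
  have oN : \sum_(i in S | i != u) #|[pred j in S | G i j]| <=
      \sum_(i in S | i != u) #|[pred j in w |: S | G i j]|.
    apply: leq_sum => i _; apply: subset_leq_card; apply/fintype.subsetP => j.
    by rewrite !inE => /andP[-> ->]; rewrite orbT.
  by apply: leq_trans (leq_add wN (leq_add uN oN)); rewrite doubleS add1n addSn !ltnS.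
have [|S Sn Sle] := H n.-1; first by lia.
apply: (leq_trans Sle); rewrite [X in _ <= X](bigID (mem S)) /=.
apply: leq_trans (leq_addr _ _); apply: leq_sum => i _.
by apply: subset_leq_card; apply/fintype.subsetP => j; rewrite !inE => /andP[].
Qed.

(** The chord closes the segment from x to y into a cycle; nonempty [s2] gives it length at least
    3. *)
Lemma acyclic_chord s1 s2 s3 x y : acyclic_graph G ->
    uniq (s1 ++ x :: s2 ++ y :: s3) -> sorted G (s1 ++ x :: s2 ++ y :: s3) ->
  0 < size s2 -> G x y -> False.
Proof.
move=> ac us ss s20 xy; apply: (ac (x :: rcons s2 y)).
  by rewrite /= size_rcons !ltnS.
have /cat_sorted2[_ /= ps] := ss.
rewrite -cat_rcons cat_path in ps; case/andP: ps => ps _.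
rewrite /ucycle /= rcons_path last_rcons ps adj_sym xy /=.
by move: us; rewrite cat_uniq => /and3P[_ _]; rewrite -cat_rcons -cat_cons cat_uniq => /andP[].
Qed.

Lemma acyclic_path_adj s x0 i j : acyclic_graph G -> uniq s -> sorted G s ->
  i < j < size s -> G (nth x0 s i) (nth x0 s j) = (j == i.+1).
Proof.
move=> ac us ss /andP[ij js]; have [->|ji] := eqVneq j i.+1.
  by move/(sortedP x0): ss; apply; lia.
apply/negP => Gij; have sE : s = take i s ++ nth x0 s i ::
    take (j - i.+1) (drop i.+1 s) ++ nth x0 s j :: drop j.+1 s.
  rewrite -(drop_nth x0 js) (_ : drop j s = drop (j - i.+1) (drop i.+1 s));
    last by rewrite drop_drop subnK.
  rewrite cat_take_drop.
  by rewrite -drop_nth ?cat_take_drop //; lia.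
apply: (@acyclic_chord (take i s) (take (j - i.+1) (drop i.+1 s)) (drop j.+1 s)
  _ _ ac _ _ _ Gij); rewrite -?sE //.
by rewrite size_take size_drop; case: ifP; lia.
Qed.

(** Duplicate-free paths have at most n vertices; quantifying over [k.-tuple] makes existence at
    each length decidable, so a maximum can be taken. *)
Lemma longest_path : 0 < n -> exists s : seq 'I_n,
  [/\ 0 < size s, uniq s, sorted G s &
      forall s', uniq s' -> sorted G s' -> size s' <= size s].
Proof.
move=> n0; pose P k := [exists p : k.-tuple 'I_n, uniq p && sorted G p].
have P1 : P 1 by apply/existsP; exists [tuple Ordinal n0].
have Pn k : P k -> k <= n.
  case/existsP => p /andP[up _].
  by rewrite -(size_tuple p) -(card_uniqP up) -[X in _ <= X]card_ord max_card.
have [m /existsP[p /andP[up sp]] mmax] := ex_maxnP (ex_intro _ 1 P1) Pn.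
exists p; split => //; first by rewrite size_tuple mmax.
by move=> s us ss; rewrite size_tuple mmax //; apply/existsP; exists (in_tuple s); rewrite us.
Qed.

(** A longest path contains all neighbours of its vertices, hence by connectedness every vertex; the
    position on it is then the isomorphism, because a path in an acyclic graph has no chords. *)
Lemma maxdeg2_path : 0 < n -> (forall u v, connect G u v) -> acyclic_graph G ->
  (forall v, deg G v <= 2) -> graph_iso G (path_graph n).
Proof.
move=> n0 conn ac d2; have [s [s0 us ss smax]] := longest_path n0.
have [x0 x0s] : exists x, x \in s by case: s s0 {us ss smax} => // x s _; exists x; rewrite inE eqxx.
have cls : fingraph.closed G (mem s).
  apply: intro_closed; first exact: sym_connect_sym (@adj_sym _ G).
  move=> v w vw vs; apply/negPn/negP => ws.
  have := index_mem v s; rewrite vs; set i := index v s => is_.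
  have vE : nth x0 s i = v by rewrite nth_index.
  (* If v is the first vertex, w can be prepended; if it is the last, w can be appended. Both
     contradict maximality. *)
  have [i0|i0] := posnP i.
    suff : size (w :: s) <= size s by rewrite ltnn.
    apply: smax; rewrite /= ?us ?andbT //.
    rewrite i0 in vE.
    by case: (s) ss vE => //= a s' -> ->; rewrite adj_sym vw.
  have [il|il] := eqVneq i.+1 (size s).
    suff : size (rcons s w) <= size s by rewrite size_rcons ltnn.
    apply: smax; first by rewrite rcons_uniq ws.
    have : last x0 s = v by rewrite -nth_last -il.
    by case: (s) ss s0 => //= a s' ss' _ lv; rewrite rcons_path ss' lv.
  (* An interior v would have three neighbours: its predecessor, its successor and w. *)
  have := d2 v; rewrite leqNgt => /negP; apply.
  have in1 : i.+1 < size s by rewrite ltn_neqAle il.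
  have a1 : G v (nth x0 s i.-1).
    by rewrite adj_sym -vE acyclic_path_adj ?prednK ?leqnn.
  have a2 : G v (nth x0 s i.+1) by rewrite -vE acyclic_path_adj ?leqnn ?in1.
  have ip : i.-1 < size s by apply: leq_ltn_trans (leq_pred i) _.
  have u3 : uniq [:: nth x0 s i.-1; nth x0 s i.+1; w].
    rewrite /= !inE nth_uniq //.
    rewrite negb_or -!andbA andbT; apply/and3P; split; first by lia.
      by apply: contraNneq ws => <-; apply: mem_nth.
    by apply: contraNneq ws => <-; apply: mem_nth.
  rewrite -[3]/(size [:: nth x0 s i.-1; nth x0 s i.+1; w]) -(card_uniqP u3).
  apply: subset_leq_card; apply/fintype.subsetP => y; rewrite !inE.
  by case/or3P => /eqP ->.
have sT v : v \in s by rewrite -[_ \in s]/(v \in mem s) -(closed_connect cls (conn x0 v)).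
have sn : size s = n.
  by rewrite -(card_uniqP us) -[RHS]card_ord; apply: eq_card => v; rewrite sT.
have fP v : index v s < n by rewrite -[X in _ < X]sn index_mem.
exists (fun v => Ordinal (fP v)).
  apply: injF_bij => u v [] /(congr1 (nth x0 s)).
  by rewrite !nth_index.
have key u v : index u s < index v s -> G u v = (index v s == (index u s).+1).
  move=> uv; rewrite -(acyclic_path_adj x0 ac us ss) ?nth_index //.
  by rewrite uv index_mem sT.
move=> u v; rewrite path_graphE /=; case: (ltngtP (index u s) (index v s)) => [uv|vu|E].
- by rewrite (key _ _ uv); lia.
- by rewrite adj_sym (key _ _ vu); lia.
have -> : u = v by rewrite -(nth_index x0 (sT u)) E nth_index.
by rewrite adj_irrefl; lia.
Qed.

End Trees.

(** * Invariance of the spectrum under isomorphism *)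

Section Isomorphism.
Variables (R : realType) (n : nat).

Lemma deg_iso (G H : sgraph n) (f : 'I_n -> 'I_n) v :
  bijective f -> (forall u v, H (f u) (f v) = G u v) -> deg H (f v) = deg G v.
Proof.
move=> bf fE; rewrite /deg -!sum1_card (reindex f) /=; last exact: onW_bij.
by apply: eq_bigl => w; rewrite !inE fE.
Qed.

Lemma eigenvalue_iso (G H : sgraph n) (f : 'I_n -> 'I_n) a :
    bijective f -> (forall u v, H (f u) (f v) = G u v) ->
  eigenvalue (ag_mx R H) a -> eigenvalue (ag_mx R G) a.
Proof.
move=> bf fE /eigenvalueP[x xA /rV0Pn[k xk]]; apply/eigenvalueP.
exists (\row_i x 0 (f i)).
  apply/rowP => j; rewrite [RHS]mxE [X in _ * X]mxE.
  have := congr1 (fun y : 'rV_n => y 0 (f j)) xA.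
  rewrite !mxE (reindex f) /=; last exact: onW_bij.
  by move=> <-; apply: eq_bigr => i _; rewrite !mxE fE !(deg_iso _ bf fE).
have [g gK fK] := bf; apply/rV0Pn; exists (g k).
by rewrite mxE fK.
Qed.

Lemma rho_ag_iso (G H : sgraph n) : graph_iso G H -> rho_ag R G = rho_ag R H.
Proof.
case=> f bf fE; congr sup; apply/seteqP; split => a /=.
  have [g gK fK] := bf; apply: (@eigenvalue_iso _ _ g); first by exists f.
  by move=> u v; rewrite -fE !fK.
exact: eigenvalue_iso bf fE.
Qed.

End Isomorphism.

(** * Connectedness and degrees of stars and paths *)

Section PathStar.
Variable n : nat.
Local Open Scope nat_scope.

Lemma star_graph_connected u v : connect (star_graph n) u v.
Proof.
have n0 : 0 < n by case: n u => // -[].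
have c0 w : connect (star_graph n) (Ordinal n0) w.
  have [->//|w0] := eqVneq w (Ordinal n0).
  by apply: connect1; rewrite star_graphE /= -[w == 0 :> nat]/(w == Ordinal n0) (negPf w0).
apply: connect_trans (c0 v); rewrite sym_connect_sym //; exact: adj_sym.
Qed.

Lemma star_graph_degD u v : star_graph n u v ->
  deg (star_graph n) u + deg (star_graph n) v = n.
Proof.
have n0 : 0 < n by case: n u => // -[].
(* Exactly one endpoint is the centre, and the claim is symmetric. The degrees are then 1 and n -
   1. *)
wlog: u v / v = Ordinal n0 => [W|->].
  rewrite star_graphE; case: (eqVneq (u : nat) 0) => [u0 v0|u0 /= v0].
    by rewrite addnC; apply: W; [exact: val_inj|rewrite star_graphE u0 addbC].
  by apply: W; [apply: val_inj; apply/eqP|rewrite star_graphE (negPf u0)].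
rewrite star_graphE /= addbT => u0.
have -> : deg (star_graph n) u = 1.
  rewrite -(card1 (Ordinal n0)); apply: eq_card => w.
  by rewrite !inE star_graphE (negPf u0).
have -> : deg (star_graph n) (Ordinal n0) = #|predC1 (Ordinal n0)|.
  by apply: eq_card => w; rewrite !inE star_graphE.
by rewrite cardC1 card_ord; lia.
Qed.

Lemma path_graph_connected u v : connect (path_graph n) u v.
Proof.
have n0 : 0 < n by case: n u => // -[].
have c0 k (kn : k < n) : connect (path_graph n) (Ordinal n0) (Ordinal kn).
  elim: k kn => [|k IH] kn; first by rewrite (bool_irrelevance n0 kn).
  apply: connect_trans (IH (ltnW kn)) _; apply: connect1.
  by rewrite path_graphE /= eqxx.
case: u v => [i ui] [j vj]; apply: connect_trans (c0 j vj).
by rewrite sym_connect_sym //; exact: adj_sym.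
Qed.

Lemma path_graph_deg_le2 u : deg (path_graph n) u <= 2.
Proof.
(* Candidates not below n are dropped by [insub]. For u = 0 the entry [u.-1] is 0 itself, which is
   harmless because only a superset of the neighbours is needed. *)
pose s := pmap (@insub nat (fun i => i < n) 'I_n) [:: u.+1; u.-1].
have ss : size s <= 2 by rewrite size_pmap (leq_trans (count_size _ _)).
apply: leq_trans ss; apply: leq_trans (card_size s).
apply: subset_leq_card; apply/fintype.subsetP => w.
rewrite inE path_graphE mem_pmap_sub /= !inE => /orP[] /eqP <-.
  by rewrite eqxx.
by rewrite eqxx orbT.
Qed.

Lemma path_graph_deg0 (u : 'I_n) : u = 0 :> nat -> deg (path_graph n) u <= 1.
Proof.
move=> u0; apply/card_le1P => v; rewrite inE path_graphE u0 orbF => /eqP v1 w.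
rewrite !inE path_graphE u0 orbF; apply/eqP/eqP => [w1|->//].
by apply: val_inj; rewrite /= -w1 v1.
Qed.

End PathStar.

(** Double counting: each d_v occurs d_v times as the degree of the outer vertex and d_v times as
    that of a neighbour. *)
Lemma sum_degD n (G : sgraph n) :
  (\sum_j \sum_(i | G j i) (deg G i + deg G j) = (\sum_j deg G j ^ 2).*2)%N.
Proof.
under eq_bigr do rewrite big_split /=; rewrite big_split /= -addnn; congr addn.
  rewrite (exchange_big_dep xpredT) //=; apply: eq_bigr => i _.
  rewrite sum_nat_const expnS expn1; congr muln; apply: eq_card => j.
  by rewrite !inE adj_sym.
by apply: eq_bigr => j _; rewrite sum_nat_const.
Qed.

(** * Spectral estimates for stars, paths and branching graphs *)

Section Bounds.
Variables (R : realType) (n : nat).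
Hypothesis n_gt1 : (1 < n)%N.

Lemma rho_ag_star : rho_ag R (star_graph n) = n%:R / 2.
Proof.
apply: rho_ag_biregular => //; first exact: star_graph_connected.
exact: star_graph_degD.
Qed.

Lemma rho_ag_path_lt2 : rho_ag R (path_graph n) < 2.
Proof.
have dle i j : path_graph n i j ->
    (deg (path_graph n) i + deg (path_graph n) j <= 4)%N.
  by move=> _; rewrite (leq_add (path_graph_deg_le2 i) (path_graph_deg_le2 j)).
have E : 4%:R / 2 = 2 :> R by field.
have conn := @path_graph_connected n.
rewrite -E lt_neqAle (rho_ag_le R n_gt1 conn dle) andbT; apply/eqP => /rho_ag_eq eq4.
(* Value 2 would force degree sum 4 on this edge, but its end vertex 0 has degree at most 1. *)
have P01 : path_graph n (Ordinal (ltnW n_gt1)) (Ordinal n_gt1) by [].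
have := eq4 n_gt1 conn dle _ _ P01; have := path_graph_deg_le2 (Ordinal n_gt1).
have := path_graph_deg0 (u := Ordinal (ltnW n_gt1)) erefl; lia.
Qed.

Lemma rho_ag_ge2 (G : sgraph n) v : (forall u v, connect G u v) ->
  (2 < deg G v)%N -> 2 <= rho_ag R G.
Proof.
move=> conn dv; have d0 := connected_deg_gt0 n_gt1 conn.
have [_ /(_ (sqrt_deg R G))] := rho_agP R G (ltnW n_gt1).
have sd j : sqrt_deg R G 0 j * sqrt_deg R G 0 j = (deg G j)%:R.
  by rewrite mxE -expr2 sqr_sqrtr ?ler0n.
have -> : dotv (sqrt_deg R G *m ag_mx R G) (sqrt_deg R G) = (\sum_j deg G j ^ 2)%N%:R.
  rewrite dotvE.
  transitivity (\sum_j (\sum_(i | G j i) (deg G i + deg G j)%:R) / 2 : R).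
    apply: eq_bigr => j _; rewrite sqrt_deg_ag //.
    rewrite -(mulrA _ (sqrt_deg R G 0 j)) (sd j); field.
    by rewrite pnatr_eq0 -lt0n d0.
  transitivity ((\sum_j \sum_(i | G j i) (deg G i + deg G j))%N%:R / 2 : R).
    by rewrite natr_sum mulr_suml; apply: eq_bigr => j _; rewrite natr_sum.
  by rewrite sum_degD -muln2 natrM mulfK // pnatr_eq0.
have -> : dotv (sqrt_deg R G) (sqrt_deg R G) = (\sum_j deg G j)%N%:R.
  by rewrite dotvE natr_sum; apply: eq_bigr => j _.
have sum_gt0 : (0 < \sum_j deg G j)%N.
  by rewrite (bigD1 v) //= ltn_addr // d0.
apply: contraTT; rewrite -!ltNge => rho2.
apply: lt_le_trans (_ : 2 * (\sum_j deg G j)%N%:R <= _); first by rewrite ltr_pM2r // ltr0n.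
rewrite -natrM ler_nat.
have := connected_sum_deg (ltnW n_gt1) conn.
(* Here d^2 + 2 - 3d = (d - 1)(d - 2) is nonnegative, and at least 2 at v. Together with sum d >=
   2(n - 1) this yields sum d^2 >= 2 sum d. *)
have : (\sum_j (3 * deg G j) + 2 <= \sum_j (deg G j ^ 2 + 2))%N.
  rewrite (bigD1 v) //= [X in (_ <= X)%N](bigD1 v) //=.
  have d3 d : (2 < d -> 3 * d + 2 <= d ^ 2 + 2)%N by rewrite expnS expn1; nia.
  have d1 d : (0 < d -> 3 * d <= d ^ 2 + 2)%N by case: d => [|[|d]] // _; rewrite expnS expn1; nia.
  by rewrite addnAC leq_add ?d3 //; apply: leq_sum => j _; exact: d1.
rewrite -big_distrr [X in (_ <= X)%N]big_split big_const_ord iter_addn_0 /=; lia.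
Qed.

Lemma rho_ag_path_ge : 2 * cos (pi / n.+1%:R) <= rho_ag R (path_graph n).
Proof.
(* The sine is sampled so as to vanish at 0 and n + 1; vertex i, counted from 0, receives
   [s i.+1]. *)
set t := pi / _; pose s k : R := sin (k%:R * t).
have n1 : n.+1%:R != 0 :> R by rewrite pnatr_eq0.
have s0 : s 0%N = 0 by rewrite /s mul0r sin0.
have sn : s n.+1 = 0 by rewrite /s mulrC divfK // sinpi.
have sgt0 k : (0 < k < n.+1)%N -> 0 < s k.
  case/andP => k0 kn; apply: sin_gt0_pi; rewrite mulr_gt0 ?ltr0n ?divr_gt0 ?pi_gt0 //=.
  by rewrite mulrCA gtr_pMr ?pi_gt0 // ltr_pdivrMr ?ltr0n // mul1r ltr_nat.
have srec k : s k + s k.+2 = 2 * cos t * s k.+1.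
  rewrite /s.
  have -> : k%:R * t = k.+1%:R * t - t by rewrite -[in RHS]natr1; ring.
  have -> : k.+2%:R * t = k.+1%:R * t + t by rewrite -[in LHS]natr1; ring.
  by rewrite sinB sinD; ring.
pose x : 'rV[R]_n := \row_i s i.+1.
have xgt0 i : 0 < x 0 i by rewrite mxE sgt0 //= ltnS.
have [_ /(_ x) ray] := rho_agP R (path_graph n) (ltnW n_gt1).
have xx : 0 < dotv x x.
  by rewrite dotv_gt0; apply/rV0Pn; exists (Ordinal n_gt1); rewrite gt_eqF.
rewrite -(ler_pM2r xx); apply: le_trans ray.
rewrite !dotvE mulr_sumr; apply: ler_sum => j _.
rewrite mulrA ler_pM2r // [x 0 j]mxE -srec.
(* At the ends of the path the missing neighbour corresponds to a zero of [s], so the empty sum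
   still suffices. *)
have prev : s j <= \sum_(i < n | i.+1 == j :> nat) x 0 i.
  case: (posnP j) => [->|j0]; first by rewrite s0 sumr_ge0 // => i _; exact: ltW.
  have jn : (j.-1 < n)%N by apply: leq_ltn_trans (leq_pred j) _.
  rewrite (big_pred1 (Ordinal jn)) => [|i]; first by rewrite mxE /= prednK.
  by rewrite /= -(inj_eq val_inj) /=; lia.
have next : s j.+2 <= \sum_(i < n | j.+1 == i :> nat) x 0 i.
  have [jn|jn] := ltnP j.+1 n; last first.
    have -> : j.+2 = n.+1 by have := ltn_ord j; lia.
    by rewrite sn sumr_ge0 // => i _; exact: ltW.
  rewrite (big_pred1 (Ordinal jn)) => [|i]; first by rewrite mxE.
  by rewrite /= -(inj_eq val_inj) /=; lia.
apply: le_trans (lerD prev next) _; rewrite mxE.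
rewrite [X in _ + X](eq_bigl (fun i : 'I_n => (path_graph n i j) && (i.+1 != j :> nat))); last first.
  by move=> i; rewrite path_graphE; lia.
rewrite [X in X + _](eq_bigl (fun i : 'I_n => (path_graph n i j) && (i.+1 == j :> nat))); last first.
  by move=> i; rewrite path_graphE; lia.
(* The left and right neighbours recombine into one sum over adjacent i, where each matrix entry is
   at least 1. *)
rewrite -bigID big_mkcond; apply: ler_sum => i _.
case: ifPn => [ij|_]; last by rewrite mulr_ge0 ?ag_mx_ge0 // ltW.
by rewrite ler_pMr // ag_mx_ge1.
Qed.

End Bounds.

Theorem theorem3p1 (R : realType) (n : nat) (T : sgraph n)
    (hn : (2 <= n)%N) (hT : is_tree T) :
  [/\ 2 * cos (pi / n.+1%:R) <= rho_ag R (path_graph n),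
      rho_ag R (path_graph n) <= rho_ag R T,
      rho_ag R T <= rho_ag R (star_graph n) &
      rho_ag R (star_graph n) = n%:R / 2] /\
  (rho_ag R (path_graph n) = rho_ag R T <-> graph_iso T (path_graph n)) /\
  (rho_ag R T = rho_ag R (star_graph n) <-> graph_iso T (star_graph n)).
Proof.
have [[n0 conn] ac] := hT; have dle u v := @acyclic_degD_le n T u v ac.
(* The value 2 separates the cases: a vertex of degree at least 3 gives a radius of at least 2, and
   without one the tree is a path. *)
have dichotomy : rho_ag R (path_graph n) < rho_ag R T \/ graph_iso T (path_graph n).
  have [/existsP[v dv]|] := boolP [exists v, (2 < deg T v)%N].
    by left; apply: lt_le_trans (rho_ag_path_lt2 R hn) (rho_ag_ge2 R hn conn dv).
  rewrite negb_exists => /forallP d2; right; apply: maxdeg2_path => // v.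
  by rewrite leqNgt d2.
have star := rho_ag_star R hn.
split; first split.
- exact: rho_ag_path_ge.
- by case: dichotomy => [/ltW //|/(@rho_ag_iso R) ->].
- by rewrite star rho_ag_le.
- exact: star.
split; split => [E|/(@rho_ag_iso R) -> //].
- by case: dichotomy => //; rewrite E ltxx.
(* Equality with n/2 forces degree sum n on every edge, which characterises the star. *)
rewrite star in E; apply: acyclic_biregular_star => //.
  have /card_gt0P[v Tv] := connected_deg_gt0 hn conn (Ordinal n0).
  by exists (Ordinal n0), v.
exact: rho_ag_eq E.
Qed.
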